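(* For any $p, c \in \mathbb{N}^+$, there exists a decoder-only Transformer model $M: \mathcal{V}^* \to \mathcal{V}$ that autoregressively decides $\operatorname{3-SAT}_{p,c}$ in no more than $p \cdot 2^{p+1}$ Chain-of-Thought iterations. The model $M$ has $L = 7$ layers, $H = 5$ attention heads, embedding dimension $d_{\text{emb}} = O(p)$, and $O(p^2)$ parameters.
   Context: Decoder-only Transformer: given tokens $s_1,\dots,s_n$ from a finite vocabulary $\mathcal{V}$, form $X^{(0)} = (\operatorname{Emb}(s_1)+p_1,\dots,\operatorname{Emb}(s_n)+p_n)\in\mathbb{R}^{n\times d}$ with a fixed token embedding and positional encoding vectors $p_i$. For $l=1,\dots,L$: $H^{(l)} = X^{(l-1)} + \operatorname{MHA}(X^{(l-1)})$ and $X^{(l)} = H^{(l)} + \operatorname{MLP}(H^{(l)})$, where $\operatorname{MHA}(X) = [\operatorname{Att}_1(X);\dots;\operatorname{Att}_H(X)]W_O$, $\operatorname{Att}_h(X) = \operatorname{softmax}\big(XW_Q^{h}(XW_K^{h})^\top/\sqrt{d_h} + \mathbf{M}\big)XW_V^{h}$ with a causal mask $\mathbf{M}$ (each position attends only to itself and earlier positions), and $\operatorname{MLP}(H) = \operatorname{ReGLU}(HW_1+b_1)W_2+b_2$ where $\operatorname{ReGLU}(u_1,u_2) = u_1\otimes\operatorname{ReLU}(u_2)$ (elementwise product of the two halves). The output token is $s_{n+1} = \arg\max_v (X^{(L)}W_{\text{out}}+b_{\text{out}})_{n,v}$ (greedy decoding). The parameter count excludes the positional encodings; the positional encoding at position $i$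 is the numerical value $i$ in one designated coordinate. Greedy autoregressive generation: starting from the prompt $s_{1:n}$, repeatedly append $s_t = M(s_{1:t-1})$ until a token in a stop set $\mathcal{E}\subseteq\mathcal{V}$ is produced; the generated tokens are the Chain-of-Thought (CoT), and each generated token is one CoT iteration. A decision problem is a map $f: L\to\{0,1\}$ on a set $L$ of strings over an alphabet $\Sigma\subseteq\mathcal{V}$. For $\mathcal{E}=\{\mathcal{E}_0,\mathcal{E}_1\}\subset\mathcal{V}$, the procedure $\mathcal{A}_{M,\mathcal{E}}$ runs greedy generation with stop tokens $\mathcal{E}$ and outputs $0$ if the generated sequence ends with $\mathcal{E}_0$ and $1$ otherwise. $M$ autoregressively decides $f$ if there is some $\mathcal{E}$ such that on every input $x\in L$, $\mathcal{A}_{M,\mathcal{E}}$ halts and outputs $f(x)$. $\operatorname{DIMACS}(p,c)$: the set of DIMACS encodings of 3-SAT formulas (CNF formulas with at most 3 literals per clause) with at most $p$ variables $x_1,\dots,x_p$ and at most $c$ clauses, where literal $x_i$ is the token $i$, literal $\lnot x_i$ is the token $-i$, each clause is written as its literal tokens followed by the token $0$, with a token [BOS] prepended and a token [SEP] appended. $\operatorname{3-SAT}_{p,c}: \operatorname{DIMACS}(p,c)\to\{0,1\}$ maps an encoding to $1$ iff the encoded formula is satisfiable. *)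

(* Defs.v *)
From HB Require Import structures.
From mathcomp Require Import all_boot all_order all_algebra.
From mathcomp Require Import reals sequences exp.
Set Implicit Arguments. Unset Strict Implicit. Unset Printing Implicit Defensive.
Import Order.TTheory GRing.Theory Num.Theory.
Local Open Scope ring_scope.

Section Transformer.
Variable R : realType.

Definition addrow (n m : nat) (A : 'M[R]_(n, m)) (b : 'rV[R]_m) : 'M[R]_(n, m) :=
  \matrix_(i, j) (A i j + b 0 j).

(* One decoder layer with H heads, embedding demb d, head demb dh, MLP hidden
   demb dff (W1 has 2*dff columns, split in two halves for ReGLU).
   The output projection W_O of size (H*dh) x d is stored as its H row
   blocks WO h : dh x d, so that [Att_1; ...; Att_H] W_O = sum_h Att_h WO h. *)
Record layer (d dh dff H : nat) := Layer {
  WQ : 'I_H -> 'M[R]_(d, dh);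
  WK : 'I_H -> 'M[R]_(d, dh);
  WV : 'I_H -> 'M[R]_(d, dh);
  WO : 'I_H -> 'M[R]_(dh, d);
  W1 : 'M[R]_(d, dff + dff);
  b1 : 'rV[R]_(dff + dff);
  W2 : 'M[R]_(dff, d);
  b2 : 'rV[R]_d }.

Definition attention (n d dh : nat) (WQh WKh WVh : 'M[R]_(d, dh))
    (X : 'M[R]_(n, d)) : 'M[R]_(n, dh) :=
  let Q := X *m WQh in
  let K := X *m WKh in
  let score (i k : 'I_n) := (\sum_(l < dh) Q i l * K k l) / Num.sqrt (dh%:R) in
  let A := \matrix_(i < n, k < n)
      (if (k <= i)%N then
         expR (score i k) / \sum_(k' < n | (k' <= i)%N) expR (score i k')
       else 0) in
  A *m (X *m WVh).

Definition MHA (n d dh dff H : nat) (l : layer d dh dff H) (X : 'M[R]_(n, d)) :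
    'M[R]_(n, d) :=
  \sum_(h < H) attention (WQ l h) (WK l h) (WV l h) X *m WO l h.

Definition ReGLU (n dff : nat) (U : 'M[R]_(n, dff + dff)) : 'M[R]_(n, dff) :=
  \matrix_(i, j) (lsubmx U i j * Num.max 0 (rsubmx U i j)).

Definition MLP (n d dh dff H : nat) (l : layer d dh dff H) (X : 'M[R]_(n, d)) :
    'M[R]_(n, d) :=
  addrow (ReGLU (addrow (X *m W1 l) (b1 l)) *m W2 l) (b2 l).

Definition layer_apply (n d dh dff H : nat) (l : layer d dh dff H)
    (X : 'M[R]_(n, d)) : 'M[R]_(n, d) :=
  let Hm := X + MHA l X in Hm + MLP l Hm.

Record transformer := Transformer {
  nV : nat;
  demb : nat;
  dh : nat;
  dff : nat;
  nL : nat;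
  nH : nat;
  Emb : 'M[R]_(nV, demb);
  pos_coord : 'I_demb;
  layers : 'I_nL -> layer demb dh dff nH;
  Wout : 'M[R]_(demb, nV);
  bout : 'rV[R]_nV }.

Definition token (M : transformer) := 'I_(nV M).

Definition input_matrix (M : transformer) (s : seq (token M)) :
    'M[R]_(size s, demb M) :=
  \matrix_(i < size s, j < demb M)
    (Emb M (tnth (in_tuple s) i) j + (if j == pos_coord M then (i.+1)%:R else 0)).

Definition forward (M : transformer) (s : seq (token M)) : 'M[R]_(size s, demb M) :=
  foldl (fun X (l : 'I_(nL M)) => layer_apply (@layers M l) X)
        (input_matrix s) (enum 'I_(nL M)).

(* logits at the last position n: (X^(L) W_out + b_out)_{n, v} *)
Definition logits (M : transformer) (s : seq (token M)) (v : token M) : R :=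
  \sum_(i < size s | i.+1 == size s) (addrow (forward s *m Wout M) (bout M)) i v.

(* greedy decoding: an argmax of the logits; ties are broken towards the
   first maximiser in the enumeration of the vocabulary. None only if the
   vocabulary is empty. *)
Definition next_token (M : transformer) (s : seq (token M)) : option (token M) :=
  [pick v | [forall w, logits s w <= logits s v]].

(* number of parameters (positional encodings excluded) *)
Definition param_count (M : transformer) : nat :=
  (nV M * demb M
   + nL M * (nH M * (3 * (demb M * dh M) + dh M * demb M)
             + demb M * (dff M + dff M) + (dff M + dff M)
             + dff M * demb M + demb M)
   + demb M * nV M + nV M)%N.

Definition greedy_cot (M : transformer) (E0 E1 : token M)
    (x t : seq (token M)) : Prop :=
  [/\ t <> [::],
      forall j, (j < size t)%N ->
        exists v, next_token (x ++ take j t) = Some v /\ nth v t j = v,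
      (last E0 t == E0) || (last E0 t == E1) &
      forall j, (j.+1 < size t)%N ->
        forall v, nth v t j != E0 /\ nth v t j != E1].

Definition cot_output (M : transformer) (E0 : token M) (t : seq (token M)) : nat :=
  if last E0 t == E0 then 0%N else 1%N.

End Transformer.

(* input alphabet: [BOS], [SEP] and integer tokens (literals and the clause
   terminator 0) *)
Inductive dtoken := BOS | SEP | Num of int.

(* a CNF formula: list of clauses, each a list of literals (nonzero ints) *)
Definition cnf := seq (seq int).

Definition valid_cnf (p c : nat) (F : cnf) : Prop :=
  (size F <= c)%N /\
  forall cl, cl \in F ->
    (0 < size cl <= 3)%N /\
    forall l, l \in cl -> l != 0%R /\ (absz l <= p)%N.

Definition dimacs (F : cnf) : seq dtoken :=
  BOS :: flatten [seq rcons (map Num cl) (Num 0) | cl <- F] ++ [:: SEP].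

Definition lit_true (a : nat -> bool) (l : int) : bool :=
  if (0 < l)%R then a (absz l) else ~~ a (absz l).

Definition satisfiable (F : cnf) : Prop :=
  exists a : nat -> bool, all (fun cl => has (lit_true a) cl) F.

Definition in_alphabet (p : nat) (x : dtoken) : Prop :=
  match x with Num z => (absz z <= p)%N | _ => True end.

(* Main.v *)
(** The chain of thought is a binary counter.  The token [Cot false j] sets bit
    [j] of the current assignment and [Cot true j] clears it, so bit [j] is a
    difference of token counts, which uniform attention followed by a
    multiplication by the position computes exactly.  Incrementing the counter
    clears bits from the lowest one up to the first zero bit, which is set: the
    next token depends only on the last token and on one bit.  Starting from
    zero, the counter overflows after [2 ^ p.+1 - 2] tokens, and by then it has
    passed through every assignment.

    The second layer attends, from each position, to the positions with the
    largest number of clause terminators before them, i.e. to the current clause.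
    The mass it puts on literals that are true under a given assignment is at
    least [1 / N] if the clause is true and tiny otherwise, where [N] bounds the
    sequence length.  With this mass in the score, the third layer concentrates
    on the terminators of falsified clauses if there are any, and on other
    positions if there are none; the machine accepts in the latter case. *)
Require Import Defs.
From HB Require Import structures.
From mathcomp Require Import all_boot all_order all_algebra.
From mathcomp Require Import reals sequences exp.
From mathcomp Require Import ring lra zify.
Import Order.TTheory GRing.Theory Num.Theory.

Set Implicit Arguments. Unset Strict Implicit. Unset Printing Implicit Defensive.
Local Open Scope ring_scope.

(** * Matrices indexed by finite types *)

Section FinTypeMatrices.
Variable R : pzSemiRingType.

Definition mx_of_fun (I J : finType) (f : I -> J -> R) : 'M[R]_(#|I|, #|J|) :=
  \matrix_(a, b) f (enum_val a) (enum_val b).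

Definition mx_of_rows (n : nat) (J : finType) (x : 'I_n -> J -> R) :
    'M[R]_(n, #|J|) :=
  \matrix_(i, b) x i (enum_val b).

Lemma mul_mx_of_fun n (I J : finType) (x : 'I_n -> I -> R) (f : I -> J -> R) :
  mx_of_rows x *m mx_of_fun f = mx_of_rows (fun i j => \sum_a x i a * f a j).
Proof.
apply/matrixP => i b; rewrite !mxE.
rewrite (reindex (@enum_val I predT)) /=; last first.
  by exists enum_rank => z _; rewrite ?enum_rankK ?enum_valK.
by apply: eq_bigr => a _; rewrite !mxE.
Qed.

End FinTypeMatrices.

(** * Transformer layers as functions on coordinates *)

Section FunctionalLayer.
Variable R : realType.

Definition causal_softmax (n : nat) (f : 'I_n -> R) (i k : 'I_n) : R :=
  if (k <= i)%N then expR (f k) / \sum_(k' < n | (k' <= i)%N) expR (f k') else 0.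

Variables (J D V : finType) (neuron : V -> J) (gate : J).

Definition attn_layer_fun (q k v : J -> D -> R) (o : D -> J -> R) n
    (x : 'I_n -> J -> R) (i : 'I_n) (j : J) : R :=
  let score (i k' : 'I_n) :=
    \sum_d (\sum_a x i a * q a d) * (\sum_a x k' a * k a d) in
  x i j + \sum_d (\sum_k' causal_softmax (score i) i k' * (\sum_a x k' a * v a d))
                 * o d j.

(** With the position coordinate as gate, the argument of the ReLU is nonnegative, so the block is a
    genuine product with the position minus one. *)
Definition glu_layer_fun (w : V -> J -> R) n (x : 'I_n -> J -> R)
    (i : 'I_n) (j : J) : R :=
  x i j + \sum_u x i (neuron u) * Num.max 0 (x i gate - 1) * w u j.

(** [WQ] is scaled by the square root of the head dimension to cancel the normalisation of the
    scores. Only head [ord0] contributes; the other four are silenced through their output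
    matrices. *)
Definition fun_layer (q k v : J -> D -> R) (o : D -> J -> R) (w : V -> J -> R) :
    layer R #|J| #|D| #|V| 5 :=
  {| WQ := fun _ => Num.sqrt (#|D|%:R) *: mx_of_fun q;
     WK := fun _ => mx_of_fun k;
     WV := fun _ => mx_of_fun v;
     WO := fun h => if h == ord0 then mx_of_fun o else 0;
     W1 := row_mx (mx_of_fun (fun a u => (a == neuron u)%:R))
                  (mx_of_fun (fun a _ => (a == gate)%:R));
     b1 := row_mx 0 (const_mx (-1));
     W2 := mx_of_fun w;
     b2 := 0 |}.

Lemma fun_layer_apply q k v o w n (x : 'I_n -> J -> R) : (0 < #|D|)%N ->
  layer_apply (fun_layer q k v o w) (mx_of_rows x) =
  mx_of_rows (glu_layer_fun w (attn_layer_fun q k v o x)).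
Proof.
move=> D_gt0; rewrite /layer_apply.
have -> : mx_of_rows x + MHA (fun_layer q k v o w) (mx_of_rows x) =
          mx_of_rows (attn_layer_fun q k v o x).
  rewrite /MHA (bigD1 ord0) //= big1 ?addr0; last first.
    by move=> h /negPf ->; rewrite mulmx0.
  rewrite /attention !mul_mx_of_fun -scalemxAr mul_mx_of_fun.
  set A := \matrix_(_, _) _.
  have -> : A *m mx_of_rows (fun i d => \sum_a x i a * v a d) =
    mx_of_rows (fun i d => \sum_k' causal_softmax (fun k' =>
      \sum_d (\sum_a x i a * q a d) * (\sum_a x k' a * k a d)) i k' *
      (\sum_a x k' a * v a d)).
    apply/matrixP => i d; rewrite !mxE; apply: eq_bigr => k' _.
    rewrite !mxE; congr (_ * _).
    have scE (k2 : 'I_n) : (\sum_(l < #|D|) (Num.sqrt #|D|%:R *: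
         mx_of_rows (fun i d => \sum_a x i a * q a d)) i l *
         mx_of_rows (fun i d => \sum_a x i a * k a d) k2 l) / Num.sqrt #|D|%:R =
       \sum_d (\sum_a x i a * q a d) * (\sum_a x k2 a * k a d).
      rewrite mulr_suml [RHS](reindex (@enum_val D predT)) /=; last first.
        by exists enum_rank => z _; rewrite ?enum_rankK ?enum_valK.
      apply: eq_bigr => l _; rewrite !mxE mulrC -(mulrA (Num.sqrt _)) mulKf //.
      by rewrite gt_eqF // sqrtr_gt0 ltr0n.
    rewrite /causal_softmax; case: ifP => // _.
    by rewrite scE; congr (_ / _); apply: eq_bigr => k2 _; rewrite scE.
  by rewrite mul_mx_of_fun; apply/matrixP => i j; rewrite !mxE.
set y := attn_layer_fun _ _ _ _ _.
rewrite /MLP /=.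
have -> : ReGLU (addrow (mx_of_rows y *m
     row_mx (mx_of_fun (fun a u => (a == neuron u)%:R))
            (mx_of_fun (fun a (_ : V) => (a == gate)%:R)))
     (row_mx 0 (const_mx (-1)))) =
   mx_of_rows (fun i u => y i (neuron u) * Num.max 0 (y i gate - 1)).
  apply/matrixP => i' u; rewrite mul_mx_row !mul_mx_of_fun [LHS]mxE.
  rewrite [lsubmx _ _ _]mxE [rsubmx _ _ _]mxE ![addrow _ _ _ _]mxE.
  rewrite !row_mxEl !row_mxEr !mxE addr0.
  congr (_ * Num.max _ (_ + _)).
    rewrite (bigD1 (neuron (enum_val u))) //= eqxx mulr1 big1 ?addr0 //.
    by move=> a /negPf ->; rewrite mulr0.
  rewrite (bigD1 gate) //= eqxx mulr1 big1 ?addr0 //.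
  by move=> a /negPf ->; rewrite mulr0.
by rewrite mul_mx_of_fun; apply/matrixP => i j; rewrite !mxE addr0.
Qed.

End FunctionalLayer.

(** * Concentration bounds for causal softmax *)

Section SoftmaxBounds.
Variables (R : realType) (n : nat).
Implicit Types (f g : 'I_n -> R) (i k : 'I_n) (A : pred 'I_n).

Lemma eq_causal_softmax f g i k :
  f =1 g -> causal_softmax f i k = causal_softmax g i k.
Proof.
move=> fg; rewrite /causal_softmax fg.
by under eq_bigr do rewrite fg.
Qed.

Lemma softmax_denominator_gt0 f i :
  0 < \sum_(k < n | (k <= i)%N) expR (f k).
Proof.
rewrite (bigD1 i) //= ltr_wpDr ?expR_gt0 //.
by apply: sumr_ge0 => k _; apply: expR_ge0.
Qed.

Lemma causal_softmax_ge0 f i k : 0 <= causal_softmax f i k.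
Proof.
rewrite /causal_softmax; case: ifP => // _.
by rewrite divr_ge0 ?expR_ge0 // ltW // softmax_denominator_gt0.
Qed.

Lemma causal_softmax_sum1 f i : \sum_k causal_softmax f i k = 1.
Proof.
rewrite /causal_softmax -big_mkcond /= -mulr_suml divff //.
by rewrite gt_eqF // softmax_denominator_gt0.
Qed.

Lemma card_causal i : #|[pred k : 'I_n | (k <= i)%N]| = i.+1.
Proof.
rewrite -[RHS]card_ord -sum1_card -[RHS]sum1_card.
by rewrite [RHS](big_ord_widen n (fun=> 1%N) (ltn_ord i)).
Qed.

Lemma causal_softmax_const (c : R) i k :
  causal_softmax (fun=> c) i k = if (k <= i)%N then (i.+1%:R)^-1 else 0.
Proof.
rewrite /causal_softmax; case: ifP => // _.
rewrite sumr_const card_causal -[expR c *+ _]mulr_natr invfM mulrA.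
by rewrite divff ?mul1r // gt_eqF // expR_gt0.
Qed.

(** The softmax denominator has at most [n] terms, none larger than the numerator. *)
Lemma causal_softmax_argmax_ge f i k0 : (k0 <= i)%N ->
  (forall k, (k <= i)%N -> f k <= f k0) ->
  (n%:R)^-1 <= causal_softmax f i k0.
Proof.
move=> le0i fmax; rewrite /causal_softmax le0i.
rewrite ler_pdivlMr ?softmax_denominator_gt0 //.
have n_gt0 : 0 < n%:R :> R by rewrite ltr0n (leq_ltn_trans _ (ltn_ord i)).
rewrite mulrC ler_pdivrMr //.
apply: (@le_trans _ _ (\sum_(k < n | (k <= i)%N) expR (f k0))).
  by apply: ler_sum => k ki; rewrite ler_expR fmax.
rewrite sumr_const card_causal -[expR _ *+ _]mulr_natr.
by rewrite ler_wpM2l ?expR_ge0 // ler_nat ltn_ord.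
Qed.

(** A gap [M] makes each weight at most [expR (- M)], and [1 + x <= expR x] turns this into [M^-1].
    Gaps polynomial in the length thus suffice, without logarithms. *)
Lemma causal_softmax_gap_le f i k0 A (M : R) : (k0 <= i)%N -> 0 < M ->
  (forall k, (k <= i)%N -> A k -> f k + M <= f k0) ->
  \sum_(k | A k) causal_softmax f i k <= n%:R / M.
Proof.
move=> le0i M_gt0 gap.
apply: (@le_trans _ _ (\sum_(k < n | A k) M^-1)); last first.
  rewrite sumr_const -[M^-1 *+ _]mulr_natl ler_wpM2r ?invr_ge0 ?(ltW M_gt0) //.
  by rewrite ler_nat -[X in (_ <= X)%N]card_ord max_card.
apply: ler_sum => k Ak; rewrite /causal_softmax.
case: ifP => ki; last by rewrite invr_ge0 ltW.
rewrite ler_pdivrMr ?softmax_denominator_gt0 //.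
rewrite mulrC ler_pdivlMr //.
apply: (@le_trans _ _ (expR (f k0))); last first.
  rewrite (bigD1 k0) //= lerDl.
  by apply: sumr_ge0 => k' _; apply: expR_ge0.
apply: (@le_trans _ _ (expR (f k + M))); last by rewrite ler_expR gap.
rewrite expRD ler_wpM2l ?expR_ge0 //.
by apply: le_trans (expR_ge1Dx _); rewrite lerDr.
Qed.

End SoftmaxBounds.

(** * The vocabulary *)

Inductive voc (p : nat) :=
  Lit of bool & 'I_p | Cot of bool & 'I_p | Vbos | Vsep | Vend | Vacc | Vrej.
Arguments Vbos {p}. Arguments Vsep {p}. Arguments Vend {p}.
Arguments Vacc {p}. Arguments Vrej {p}.

Section Vocabulary.
Variable p : nat.

Definition voc_code (x : voc p) : (bool * bool * 'I_p) + 'I_5 :=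
  match x with
  | Lit b j => inl (false, b, j)
  | Cot b j => inl (true, b, j)
  | Vbos => inr (inord 0)
  | Vsep => inr (inord 1)
  | Vend => inr (inord 2)
  | Vacc => inr (inord 3)
  | Vrej => inr (inord 4)
  end.

Definition voc_decode (y : (bool * bool * 'I_p) + 'I_5) : voc p :=
  match y with
  | inl (false, b, j) => Lit b j
  | inl (true, b, j) => Cot b j
  | inr k => nth Vbos [:: Vbos; Vsep; Vend; Vacc; Vrej] k
  end.

Lemma voc_codeK : cancel voc_code voc_decode.
Proof. by case=> [b j|b j| | | | |] //=; rewrite inordK. Qed.

Lemma voc_decodeK : cancel voc_decode voc_code.
Proof.
case=> [[[[] b] j]|[k ltk]] //=.
by do 5?[case: k ltk => [|k] ltk] => //=; congr inr; apply: val_inj; rewrite /= inordK.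
Qed.

HB.instance Definition _ := Finite.copy (voc p) (can_type voc_codeK).

Lemma card_voc : #|{: voc p}| = (4 * p + 5)%N.
Proof.
rewrite (bij_eq_card (Bijective voc_codeK voc_decodeK)).
by rewrite card_sum !card_prod !card_bool !card_ord; lia.
Qed.

End Vocabulary.

Lemma big_option_type (R : nmodType) (T : finType) (F : option T -> R) :
  \sum_d F d = F None + \sum_u F (Some u).
Proof.
rewrite (bigD1 None) //=; congr (_ + _).
rewrite (reindex_omap Some id) /=; last by case.
by apply: eq_bigl => u; rewrite eqxx.
Qed.

Lemma sum_mulr0 (R : pzSemiRingType) (T : finType) (F : T -> R) :
  \sum_v F v * 0 = 0.
Proof. by apply: big1 => v _; rewrite mulr0. Qed.

Lemma sum_mul_delta (R : pzSemiRingType) (T : finType) (F : T -> R) (u : T) :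
  \sum_v F v * (v == u)%:R = F u.
Proof.
rewrite (bigD1 u) //= eqxx mulr1 big1 ?addr0 // => v /negPf ->.
by rewrite mulr0.
Qed.

Lemma sum_delta_mul (R : pzSemiRingType) (T : finType) (F : T -> R) (u : T) :
  \sum_v (u == v)%:R * F v = F u.
Proof.
rewrite (bigD1 u) //= eqxx mul1r big1 ?addr0 // => v.
by rewrite eq_sym => /negPf ->; rewrite mul0r.
Qed.

(* Residual coordinates: one-hot token [cE], token counts [cP], token
   distribution of the current clause [cG], position [cpos], and [cU], which
   ends up near 1 when some clause is falsified and near 0 otherwise. *)
Notation residual_coord p := (voc p + voc p + voc p + bool)%type.
Notation cE v := (inl (inl (inl v))).
Notation cP v := (inl (inl (inr v))).
Notation cG v := (inl (inr v)).
Notation cpos := (inr true).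
Notation cU := (inr false).

(** * Weights of the working layers and the residual streams they compute *)

Section Model.
Variables (R : realType) (p : nat) (beta gamma theta : R).
Notation V := (voc p).
Notation J := (residual_coord p).
Notation D := (option V).

Definition copy_value (a : J) (d : D) : R :=
  match a, d with cE v, Some u => (v == u)%:R | _, _ => 0 end.
Definition to_counts (d : D) (j : J) : R :=
  match d, j with Some u, cP v => (u == v)%:R | _, _ => 0 end.
Definition to_clause (d : D) (j : J) : R :=
  match d, j with Some u, cG v => (u == v)%:R | _, _ => 0 end.
Definition counts_out (u : V) (j : J) : R :=
  if j is cP v then (u == v)%:R else 0.

(** Only the channel [None] enters the score: [beta] times the number of terminators up to the key,
    the key itself excluded. A terminator therefore has the same index as the literals of the clause
    it closes. *)
Definition clause_query (a : J) (d : D) : R :=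
  match a, d with cE _, None => 1 | _, _ => 0 end.
Definition clause_key (a : J) (d : D) : R :=
  match a, d with
  | cP v, None => beta * (v == Vend)%:R
  | cE v, None => - (beta * (v == Vend)%:R)
  | _, _ => 0
  end.

(* [Cot false j] sets bit [j] and [Cot true j] clears it, so bit [j] is the
   difference of their counts; the truth value of a literal is affine in it. *)
Definition truth_const (u : V) : R := if u is Lit false _ then 1 else 0.
Definition truth_coef (u v : V) : R :=
  if u is Lit b j then
    (if b then 1 else -1) * ((v == Cot false j)%:R - (v == Cot true j)%:R)
  else 0.

(** The query carries the truth values under the current assignment, the key the contents of the
    clause at the attended position. Their inner product tests every clause with a single head; the
    channel [None] adds a bonus for terminators. *)
Definition check_query (a : J) (d : D) : R :=
  match a, d with
  | cE _, None => 1
  | cE _, Some u => truth_const u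
  | cP v, Some u => truth_coef u v
  | _, _ => 0
  end.
Definition check_key (a : J) (d : D) : R :=
  match a, d with
  | cE v, None => theta * (v == Vend)%:R
  | cG v, Some u => - (gamma * (v == u)%:R)
  | _, _ => 0
  end.
Definition check_value (a : J) (d : D) : R :=
  match a, d with cE v, None => (v == Vend)%:R | _, _ => 0 end.
Definition to_check (d : D) (j : J) : R :=
  match d, j with None, cU => 1 | _, _ => 0 end.

(** Clearing bit [j] passes the carry on to bit [j.+1], and [None] signals overflow; after any other
    token a new increment starts at bit 0. *)
Definition next_bit (v : V) : option nat :=
  match v with
  | Cot true j => if (j.+1 < p)%N then Some j.+1 else None
  | _ => Some 0%N
  end.

(** The [Cot] token of the right bit and polarity gets 5, every other [Cot] token at most 4. [Vrej]
    gets 9/2 on overflow, when [Cot] tokens get at most 1. [Vacc] gets at least 19/2 if [cU] is at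
    most 1/20, and at most 1/2 if [cU] is at least 19/20. *)
Definition out_weight (a : J) (w : V) : R :=
  match w with
  | Cot c j =>
      match a with
      | cE v => 4 * (next_bit v == Some (j : nat))%:R + truth_const (Lit c j)
      | cP v => truth_coef (Lit c j) v
      | _ => 0
      end
  | Vacc => match a with cE _ => 10 | cU => -10 | _ => 0 end
  | Vrej => if a is cE v then 9 / 2 * (next_bit v == None)%:R else 0
  | _ => 0
  end.

Section Run.
Variables (n : nat) (tok : 'I_n -> V).
Implicit Types (i k : 'I_n) (v u : V) (P G : 'I_n -> V -> R) (U : 'I_n -> R).

Definition residual P G U i (j : J) : R :=
  match j with
  | cE v => (tok i == v)%:R
  | cP v => P i v
  | cG v => G i v
  | cpos => i.+1%:R
  | cU => U i
  end.

Lemma sum_residual P G U i (f : J -> R) :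
  \sum_a residual P G U i a * f a =
  f (cE (tok i)) + \sum_v P i v * f (cP v) + \sum_v G i v * f (cG v)
    + i.+1%:R * f cpos + U i * f cU.
Proof.
rewrite !big_sumType big_bool /= !addrA; congr (_ + _ + _ + _ + _).
exact: sum_delta_mul (fun v => f (cE v)) (tok i).
Qed.

Definition token_count i v : R := \sum_(k < n | (k <= i)%N) (tok k == v)%:R.
Definition clause_index k : R := token_count k Vend - (tok k == Vend)%:R.
Definition clause_weight i k := causal_softmax (fun k => beta * clause_index k) i k.
Definition clause_mass i v : R := \sum_k clause_weight i k * (tok k == v)%:R.
Definition truth i u : R :=
  truth_const u + \sum_v token_count i v * truth_coef u v.
Definition check_score i k : R :=
  theta * (tok k == Vend)%:R - gamma * \sum_u truth i u * clause_mass k u.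
Definition falsified i : R :=
  \sum_k causal_softmax (check_score i) i k * (tok k == Vend)%:R.

Notation mk_layer := (@fun_layer R J D V (fun v => cP v) cpos).

(** Zero scores make attention uniform, so position [i] receives counts divided by [i.+1]; the MLP
    adds [i] times that, and the residual sum is the integer count. *)
Lemma layer_counts :
  layer_apply (mk_layer (fun _ _ => 0) (fun _ _ => 0) copy_value to_counts counts_out)
    (mx_of_rows (residual (fun _ _ => 0) (fun _ _ => 0) (fun=> 0)))
  = mx_of_rows (residual token_count (fun _ _ => 0) (fun=> 0)).
Proof.
rewrite fun_layer_apply ?card_option //; set x := residual _ _ _.
have attE i j : attn_layer_fun (fun _ _ => 0) (fun _ _ => 0) copy_value to_counts x i j
    = x i j + if j is cP v then token_count i v / i.+1%:R else 0.
  rewrite /attn_layer_fun big_option_type mulr0 add0r; congr (_ + _).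
  transitivity (\sum_u token_count i u / i.+1%:R * to_counts (Some u) j).
    apply: eq_bigr => u _; congr (_ * _).
    rewrite /token_count mulr_suml [RHS]big_mkcond; apply: eq_bigr => k _.
    rewrite (eq_causal_softmax _ _ (g := fun=> 0)); last first.
      move=> k'; apply: big1 => d _; rewrite big1 ?mul0r // => a _.
      by rewrite mulr0.
    rewrite causal_softmax_const sum_residual /=.
    rewrite !sum_mulr0 !mulr0 !addr0.
    by case: ifP => _; rewrite ?mul0r // mulrC.
  case: j => [[[v|v]|v]|[]] /=; rewrite ?sum_mulr0 //.
  exact: sum_mul_delta (fun u => token_count i u / i.+1%:R) v.
apply/matrixP => i b; rewrite !mxE /glu_layer_fun; move: (enum_val b) => {b} j.
rewrite !attE; case: j => [[[v|v]|v]|[]] /=;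
  rewrite ?sum_mulr0 ?addr0 //.
under eq_bigr do rewrite attE /= !add0r.
rewrite (sum_mul_delta (fun u => token_count i u / i.+1%:R *
   Num.max 0 (i.+1%:R - 1))) add0r.
rewrite max_r; last by rewrite -natr1 addrK.
by rewrite -natr1 addrK; field; rewrite natr1 pnatr_eq0.
Qed.

Lemma glu_layer_fun0 (x : 'I_n -> J -> R) i j :
  glu_layer_fun (fun v => cP v) cpos (fun (_ : V) _ => 0) x i j = x i j.
Proof. by rewrite /glu_layer_fun big1 ?addr0 // => u _; rewrite mulr0. Qed.

Lemma layer_clause :
  layer_apply (mk_layer clause_query clause_key copy_value to_clause (fun _ _ => 0))
    (mx_of_rows (residual token_count (fun _ _ => 0) (fun=> 0)))
  = mx_of_rows (residual token_count clause_mass (fun=> 0)).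
Proof.
rewrite fun_layer_apply ?card_option //; set x := residual _ _ _.
apply/matrixP => i b; rewrite !mxE glu_layer_fun0; move: (enum_val b) => {b} j.
rewrite /attn_layer_fun big_option_type mulr0 add0r.
transitivity (x i j + \sum_u clause_mass i u * to_clause (Some u) j).
  congr (_ + _); apply: eq_bigr => u _; congr (_ * _).
  apply: eq_bigr => k _; congr (_ * _).
    apply: eq_causal_softmax => k'.
    rewrite big_option_type !sum_residual /=.
    rewrite [X in _ + X = _]big1; last first.
      by move=> w _; rewrite !sum_residual /= !sum_mulr0 !mulr0 !addr0 mul0r.
    rewrite !sum_mulr0 !mulr0 !addr0 mul1r /clause_index.
    under eq_bigr do rewrite mulrCA.
    by rewrite -mulr_sumr sum_mul_delta mulrBr addrC.
  by rewrite sum_residual /= !sum_mulr0 !mulr0 !addr0.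
case: j => [[[v|v]|v]|[]] /=; rewrite ?sum_mulr0 ?addr0 //.
by rewrite sum_mul_delta add0r.
Qed.

Lemma layer_check :
  layer_apply (mk_layer check_query check_key check_value to_check (fun _ _ => 0))
    (mx_of_rows (residual token_count clause_mass (fun=> 0)))
  = mx_of_rows (residual token_count clause_mass falsified).
Proof.
rewrite fun_layer_apply ?card_option //; set x := residual _ _ _.
apply/matrixP => i b; rewrite !mxE glu_layer_fun0; move: (enum_val b) => {b} j.
rewrite /attn_layer_fun big_option_type [X in _ + (_ + X) = _]big1 ?addr0; last first.
  by move=> u _; rewrite /to_check; case: j => [[[v|v]|v]|[]]; rewrite mulr0.
transitivity (x i j + falsified i * to_check None j).
  congr (_ + _ * _); apply: eq_bigr => k _; congr (_ * _).
    apply: eq_causal_softmax => k'.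
    rewrite big_option_type !sum_residual /= !(mulr0, addr0, mul0r).
    rewrite !sum_mulr0 !addr0 mul1r.
    congr (_ + _); rewrite -mulrN1 mulrAC mulrC mulr_suml; apply: eq_bigr => u _.
    rewrite !sum_residual /= !(mulr0, addr0, mul0r).
    rewrite !sum_mulr0 !addr0 !add0r.
    under [X in _ * X]eq_bigr do rewrite mulrN mulrCA.
    by rewrite sumrN -mulr_sumr sum_mul_delta /truth; ring.
  by rewrite sum_residual /= !sum_mulr0 !mulr0 !addr0.
by case: j => [[[v|v]|v]|[]] /=; rewrite ?mulr0 ?addr0 // mulr1 add0r.
Qed.

Lemma layer_idle (x : 'I_n -> J -> R) :
  layer_apply (mk_layer (fun _ _ => 0) (fun _ _ => 0) (fun _ _ => 0)
     (fun _ _ => 0) (fun _ _ => 0)) (mx_of_rows x) = mx_of_rows x.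
Proof.
rewrite fun_layer_apply ?card_option //.
apply/matrixP => i b; rewrite !mxE glu_layer_fun0 /attn_layer_fun.
by rewrite big1 ?addr0 // => d _; rewrite mulr0.
Qed.

Definition logit_spec i (w : V) : R :=
  match w with
  | Cot c j => 4 * (next_bit (tok i) == Some (j : nat))%:R + truth i (Lit c j)
  | Vacc => 10 - 10 * falsified i
  | Vrej => 9 / 2 * (next_bit (tok i) == None)%:R
  | _ => 0
  end.

Lemma sum_out_weight i w :
  \sum_a residual token_count clause_mass falsified i a * out_weight a w =
  logit_spec i w.
Proof.
rewrite sum_residual; case: w => [b j|c j| | | | |] /=;
  rewrite ?sum_mulr0 ?mulr0 ?addr0 //.
- by rewrite /truth !addrA.
- by rewrite mulrN mulrC.
Qed.

End Run.
End Model.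

(** * Sequential evaluation of a CNF formula *)

Section ClauseScan.
Variables (p : nat) (T : pred (voc p)).
Implicit Type s : seq (voc p).

(** The flag [seen] remembers a witness in the clause being read. An unterminated remainder counts
    as satisfied, so [SEP] and the chain of thought after the last clause cannot change the
    answer. *)
Fixpoint scan (seen : bool) s : bool :=
  if s is x :: s' then
    if x == Vend then seen && scan false s' else scan (seen || T x) s'
  else true.

Definition clause_rank s k := count_mem Vend (take k s).

(** The positional form in which attention sees the formula: equal [clause_rank] means same clause.
    The second alternative covers a suffix whose first clause had its witness cut off. *)
Definition clauses_witnessed (seen : bool) s :=
  forall k, (k < size s)%N -> nth Vbos s k = Vend ->
  (exists2 k', (k' <= k)%N &
     clause_rank s k' = clause_rank s k /\ T (nth Vbos s k')) \/
  (seen /\ clause_rank s k = 0%N).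

Lemma scanP seen s : ~~ T Vend -> reflect (clauses_witnessed seen s) (scan seen s).
Proof.
move=> TVend; elim: s seen => [|x s IHs] seen /=; first by constructor.
have [->|x_end] := eqVneq x Vend.
  case: seen => /=; last first.
    constructor=> /(_ 0%N isT erefl) [[k']|[]] //.
    by rewrite leqn0 => /eqP -> [_] /=; rewrite (negPf TVend).
  apply: (iffP (IHs false)) => wit.
    case=> [|k] /=; first by right.
    move=> ltk sk; left; case: (wit k ltk sk) => [[k' lek [rk Tk]]|[]] //.
    by exists k'.+1 => //; rewrite /clause_rank /= eqxx -/(clause_rank s k') rk.
  move=> k ltk sk; left.
  case: (wit k.+1 ltk sk) => [[[|k'] lek [rk Tk]]|[_]]; last 1 first.
  - by rewrite /clause_rank /= eqxx.
  - by move: Tk; rewrite /= (negPf TVend).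
  by exists k' => //; split=> //; move: rk; rewrite /clause_rank /= eqxx => -[].
apply: (iffP (IHs (seen || T x))) => wit.
  case=> [|k] /=; first by move=> _ xE; rewrite xE eqxx in x_end.
  move=> ltk sk; case: (wit k ltk sk) => [[k' lek [rk Tk]]|[]].
    by left; exists k'.+1 => //; rewrite /clause_rank /= (negPf x_end).
  case/orP=> [seenT|Tx] rk.
    by right; rewrite /clause_rank /= (negPf x_end).
  by left; exists 0%N => //; rewrite /clause_rank /= (negPf x_end) -/(clause_rank s k) rk.
move=> k ltk sk.
case: (wit k.+1 ltk sk) => [[[|k'] lek [rk Tk]]|[]].
- right; split; first by rewrite -[T x]/(T (nth Vbos (x :: s) 0)) Tk orbT.
  by move: rk; rewrite /clause_rank /= (negPf x_end).
- left; exists k' => //; split=> //.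
  by move: rk; rewrite /clause_rank /= (negPf x_end).
by move=> -> rk; right; move: rk; rewrite /clause_rank /= (negPf x_end).
Qed.

Lemma clause_rank_mono s k k' : (k <= k')%N -> (clause_rank s k <= clause_rank s k')%N.
Proof.
move=> le_k; rewrite /clause_rank -(subnKC le_k) takeD count_cat.
exact: leq_addr.
Qed.

End ClauseScan.

(** * Quantitative analysis of the clause check *)

Section Analysis.
Variables (R : realType) (p n N : nat) (s : seq (voc p)) (tok : 'I_n -> voc p).
Hypotheses (size_s : size s = n) (tokE : forall k, tok k = nth Vbos s k).
Hypotheses (le_nN : (n <= N)%N).

(** One rank is a score gap of [beta], so the mass on true literals is at most [1 / (4N)] for a
    falsified clause and at least [1 / N] for a true one. Scaled by [gamma] these become [20N] and
    [80N]; [theta = 40N] separates them, leaving gaps of at least [20N] and hence an error of at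
    most 1/20. *)
Let beta : R := 4 * N%:R ^+ 2.
Let gamma : R := 80 * N%:R ^+ 2.
Let theta : R := 40 * N%:R.

Lemma sum_tok_count v m : (m <= n)%N ->
  \sum_(k < n | (k < m)%N) (tok k == v)%:R = (count_mem v (take m s))%:R :> R.
Proof.
move=> le_mn.
under eq_bigr do rewrite tokE.
rewrite -(big_ord_widen n (fun k => (nth Vbos s k == v)%:R : R) le_mn).
elim: m le_mn => [|m IHm] lt_mn; first by rewrite big_ord0 take0.
rewrite big_ord_recr /= IHm ?(ltnW lt_mn) // (take_nth Vbos) ?size_s //.
by rewrite -cats1 count_cat /= addn0 natrD.
Qed.

Lemma token_count_last (i : 'I_n) v : i.+1 = n ->
  token_count R tok i v = (count_mem v s)%:R.
Proof.
move=> iE; rewrite /token_count -[s in RHS](take_size s) size_s.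
by rewrite -sum_tok_count //; apply: eq_bigl => k; rewrite ltn_ord -ltnS iE ltn_ord.
Qed.

Lemma clause_indexE (k : 'I_n) : clause_index R tok k = (clause_rank s k)%:R.
Proof.
rewrite /clause_index /token_count (bigD1 k) //= addrAC subrr add0r /clause_rank.
rewrite -sum_tok_count ?(ltnW (ltn_ord k)) //.
by apply: eq_bigl => k'; rewrite [RHS]ltn_neqAle andbC.
Qed.

Variables (i i0 : 'I_n) (a : nat -> bool).
Hypotheses (i_last : i.+1 = n) (i0E : i0 = 0%N :> nat) (tok0 : tok i0 = Vbos).
Hypothesis (bits : forall j : 'I_p,
  count_mem (Cot false j) s = (count_mem (Cot true j) s + a j)%N).

Definition lit_holds (b : nat -> bool) (u : voc p) : bool :=
  if u is Lit c j then b j == c else false.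

Lemma truthE u : truth R tok i u = (lit_holds a u)%:R.
Proof.
rewrite /truth; case: u => [c j|c j| | | | |] /=; try by rewrite add0r sum_mulr0.
under eq_bigr do rewrite mulrCA mulrBr.
rewrite -mulr_sumr big_split /= sumrN !sum_mul_delta !token_count_last //.
by rewrite bits natrD; case: c; case: (a j) => /=; ring.
Qed.

Lemma truth_massE (k : 'I_n) :
  \sum_u truth R tok i u * clause_mass beta tok k u =
  \sum_(k' | lit_holds a (tok k')) clause_weight beta tok k k'.
Proof.
rewrite /clause_mass.
under eq_bigr do rewrite truthE mulr_sumr.
rewrite exchange_big [RHS]big_mkcond /=; apply: eq_bigr => k' _.
under eq_bigr do rewrite mulrCA.
rewrite -mulr_sumr.
under eq_bigr do rewrite mulrC.
rewrite (sum_delta_mul (fun u => (lit_holds a u)%:R)).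
by case: ifP => _; rewrite ?mulr1 ?mulr0.
Qed.

Let N_gt0 : 0 < N%:R :> R.
Proof. by rewrite ltr0n; apply: leq_trans le_nN; rewrite -i_last. Qed.

Let n_leN : n%:R <= N%:R :> R. Proof. by rewrite ler_nat. Qed.

(** Rank is monotone, so a position in the clause of [k] maximises the attention score among those
    visible from [k]. *)
Lemma truth_mass_ge (k k' : 'I_n) : (k' <= k)%N ->
  clause_rank s k' = clause_rank s k -> lit_holds a (tok k') ->
  N%:R^-1 <= \sum_u truth R tok i u * clause_mass beta tok k u.
Proof.
move=> le_k rk Tk; rewrite truth_massE (bigD1 k') //=.
apply: (@le_trans _ _ (clause_weight beta tok k k')); last first.
  by rewrite lerDl; apply: sumr_ge0 => k2 _; apply: causal_softmax_ge0.
apply: (@le_trans _ _ n%:R^-1).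
  by rewrite lef_pV2 // posrE // ltr0n -i_last.
apply: causal_softmax_argmax_ge => // k2 le_k2.
rewrite !clause_indexE rk ler_wpM2l //; first by rewrite /beta mulr_ge0 ?sqr_ge0.
by rewrite ler_nat clause_rank_mono.
Qed.

(** Position [k] itself is the comparison point: each visible true literal lies at least one rank,
    hence [beta], below it. *)
Lemma truth_mass_le (k : 'I_n) :
  (forall k' : 'I_n, (k' <= k)%N -> lit_holds a (tok k') ->
     (clause_rank s k' < clause_rank s k)%N) ->
  \sum_u truth R tok i u * clause_mass beta tok k u <= (4 * N%:R)^-1.
Proof.
move=> rk; rewrite truth_massE.
have beta_gt0 : 0 < beta by rewrite mulr_gt0 ?exprn_gt0.
apply: (@le_trans _ _ (n%:R / beta)); last first.
  rewrite ler_pdivrMr // /beta.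
  have -> : (4 * N%:R)^-1 * (4 * N%:R ^+ 2) = N%:R :> R by field; rewrite gt_eqF.
  exact: n_leN.
apply: (@causal_softmax_gap_le _ _ _ _ k) => // k' le_k Tk.
rewrite !clause_indexE -[X in _ + X <= _]mulr1 -mulrDr ler_wpM2l ?(ltW beta_gt0) //.
by rewrite natr1 ler_nat rk.
Qed.

Lemma truth_mass_ge0 (k : 'I_n) :
  0 <= \sum_u truth R tok i u * clause_mass beta tok k u.
Proof.
by rewrite truth_massE; apply: sumr_ge0 => k' _; apply: causal_softmax_ge0.
Qed.

Lemma falsified_sum :
  falsified beta gamma theta tok i =
  \sum_(k | tok k == Vend) causal_softmax (check_score beta gamma theta tok i) i k.
Proof.
rewrite /falsified [RHS]big_mkcond; apply: eq_bigr => k _.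
by case: ifP => _; rewrite ?mulr1 ?mulr0.
Qed.

Let gap_bound : n%:R / (20 * N%:R) <= 20^-1 :> R.
Proof.
rewrite ler_pdivrMr ?mulr_gt0 //.
by have -> : 20^-1 * (20 * N%:R) = N%:R :> R by field.
Qed.

(** The first position is the comparison point: it has score 0, while terminators of true clauses
    fall to [- 40N] or lower. *)
Lemma falsified_le : scan (lit_holds a) false s ->
  falsified beta gamma theta tok i <= 20^-1.
Proof.
move=> /scanP => /(_ isT) wit; rewrite falsified_sum; apply: le_trans gap_bound.
apply: (@causal_softmax_gap_le _ _ _ _ i0); rewrite ?i0E // ?mulr_gt0 //.
move=> k _ /eqP tok_k.
(* Under the causal mask position 0 attends only to itself, and [Vbos] is no literal. *)
have -> : check_score beta gamma theta tok i i0 = 0.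
  have /negPf bos_end : Vbos != Vend :> voc p by apply/eqP.
  rewrite /check_score tok0 bos_end mulr0 sub0r truth_massE big1 ?mulr0 ?oppr0 //.
  move=> k' Tk'; rewrite /clause_weight /causal_softmax i0E leqn0.
  case: ifP => // /eqP k'0; move: Tk'.
  by have -> : k' = i0 by [apply: val_inj; rewrite /= k'0 i0E]; rewrite tok0.
rewrite /check_score tok_k eqxx mulr1.
have [||[k' le_k [rk Tk]]|[]//] := wit k; rewrite ?size_s -?tokE //.
have lt_k : (k' < n)%N by apply: leq_ltn_trans (ltn_ord k).
have := @truth_mass_ge k (Ordinal lt_k) le_k rk.
rewrite tokE => /(_ Tk) mass_ge.
have : gamma * N%:R^-1 <=
   gamma * \sum_u truth R tok i u * clause_mass beta tok k u.
  by rewrite ler_wpM2l // mulr_ge0 ?sqr_ge0.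
have -> : gamma * N%:R^-1 = 80 * N%:R by rewrite /gamma; field; rewrite gt_eqF.
rewrite /theta; move: N_gt0 (gamma * _) => N0 m; lra.
Qed.

Lemma falsified_ge : ~~ scan (lit_holds a) false s ->
  1 - 20^-1 <= falsified beta gamma theta tok i.
Proof.
move=> not_scan.
(* If every terminator had a visible true literal of no smaller rank, monotonicity would make the
   ranks equal and [scanP] would apply. *)
have [k tok_k rk] : exists2 k : 'I_n, tok k = Vend &
    forall k' : 'I_n, (k' <= k)%N -> lit_holds a (tok k') ->
     (clause_rank s k' < clause_rank s k)%N.
  have [/existsP[k /andP[/eqP tk /forallP rk]]|] := boolP [exists k : 'I_n,
    (tok k == Vend) && [forall k' : 'I_n, (k' <= k)%N ==> lit_holds a (tok k') ==>
     (clause_rank s k' < clause_rank s k)%N]].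
    by exists k => // k' le_k Tk; move: (rk k'); rewrite le_k Tk.
  rewrite negb_exists => /forallP no_k; case/negP: not_scan.
  apply/scanP => // k; rewrite size_s => lt_k sk; left.
  move: (no_k (Ordinal lt_k)); rewrite tokE sk eqxx /=.
  rewrite negb_forall => /existsP[k']; rewrite !negb_imply -leqNgt => /and3P[le_k Tk rk].
  exists k' => //; split; last by rewrite -tokE.
  by apply/eqP; rewrite eqn_leq rk clause_rank_mono.
(* The weights sum to 1, so it suffices to bound the weight off the terminators: scores there are at
   most 0, that of [k] is at least [20N]. *)
rewrite lerBlDr -[X in X <= _](causal_softmax_sum1 (check_score beta gamma theta tok i) i).
rewrite (bigID (fun k => tok k == Vend)) /= -falsified_sum lerD2l.
apply: le_trans gap_bound.
have le_i (k' : 'I_n) : (k' <= i)%N by rewrite -ltnS i_last.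
apply: (@causal_softmax_gap_le _ _ _ _ k); rewrite ?mulr_gt0 // => k' _ /negPf tk'.
rewrite /check_score tk' tok_k eqxx mulr0 mulr1 sub0r.
have := truth_mass_le rk; have := truth_mass_ge0 k'.
move: (\sum_u _) (\sum_u _) => m m' m'_ge0 m_le.
have g_ge0 : 0 <= gamma by rewrite mulr_ge0 ?sqr_ge0.
have h1 : 0 <= gamma * m' by rewrite mulr_ge0.
have h2 : gamma * m <= gamma * (4 * N%:R)^-1 by rewrite ler_wpM2l.
have gE : gamma * (4 * N%:R)^-1 = 20 * N%:R by rewrite /gamma; field; rewrite gt_eqF.
rewrite gE in h2; rewrite /theta; lra.
Qed.

End Analysis.

(** * Binary values and popcounts *)

Section BinaryCounter.
Local Open Scope nat_scope.
Implicit Types (a : nat -> bool) (w : nat -> nat) (i j p : nat).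

Definition weight w p a := \sum_(i < p) a i * w i.
Definition value p a := weight (expn 2) p a.
Definition popcount p a := weight (fun=> 1) p a.

Definition set_bit a j (b : bool) : nat -> bool := fun i => if i == j then b else a i.

(** Additions on both sides avoid truncated subtraction. *)
Lemma weight_set_bit w p a j b : j < p ->
  weight w p (set_bit a j b) + a j * w j = weight w p a + b * w j.
Proof.
move=> lt_jp; rewrite /weight (bigD1 (Ordinal lt_jp)) //=.
rewrite [in RHS](bigD1 (Ordinal lt_jp)) //= /set_bit eqxx.
rewrite (eq_bigr (fun i : 'I_p => a i * w i)); first lia.
by move=> i; rewrite -val_eqE => /negPf /= ->.
Qed.

Lemma valueS p a : value p.+1 a = a 0 + 2 * value p (a \o succn).
Proof.
rewrite /value /weight big_ord_recl expn0 muln1 big_distrr /=; congr (_ + _).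
by apply: eq_bigr => i _; rewrite /bump /= add1n expnS mulnCA.
Qed.

Lemma value_inj p a a' : value p a = value p a' -> forall i, i < p -> a i = a' i.
Proof.
elim: p a a' => // p IHp a a'; rewrite !valueS => eq_val.
have [eq0 eqS] : a 0 = a' 0 /\ value p (a \o succn) = value p (a' \o succn).
  by move: eq_val; case: (a 0); case: (a' 0) => /=; lia.
by case=> // i lt_i; apply: (IHp _ _ eqS).
Qed.

(** With the low [j] bits zero, the value is a multiple of [2 ^ j] below [2 ^ p]. *)
Lemma value_carry_le p a j : j <= p -> (forall i, i < j -> a i = false) ->
  value p a + 2 ^ j <= 2 ^ p.
Proof.
elim: p a j => [|p IHp] a j.
  by rewrite leqn0 => /eqP -> _; rewrite /value /weight big_ord0.
rewrite valueS expnS; case: j => [|j] lt_jp low.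
  have := IHp (a \o succn) 0 isT; rewrite expn0 => /(_ (fun _ => ltac:(by []))).
  by case: (a 0) => /=; lia.
have := IHp (a \o succn) j lt_jp (fun i lt_i => low i.+1 lt_i).
by rewrite expnS low //=; lia.
Qed.

End BinaryCounter.

(** * The run of the counter *)

Section CounterRun.
Local Open Scope nat_scope.
Variables (p : nat) (test : (nat -> bool) -> bool).
Hypothesis test_value : forall a a', value p a = value p a' -> test a = test a'.

Definition is_cot (v : voc p) : bool := if v is Cot _ _ then true else false.

(* [j] is the position of a carry still to be added to [a]; every assignment
   below the pending value [value p a + 2 ^ j] was the current one at some
   earlier time.  Each step increases [2 * (value p a + 2 ^ j) - popcount p a]
   by exactly one, whence the length formula. *)
Record counter_state (h : seq (voc p)) (a : nat -> bool) (j : nat) : Prop := {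
  carry_le : j <= p;
  carry_low : forall i, i < j -> a i = false;
  carry_next : next_bit (last Vsep h) = if j < p then Some j else None;
  counter_bits : forall i : 'I_p,
    count_mem (Cot false i) h = count_mem (Cot true i) h + a i;
  counter_size : size h + 2 + popcount p a = 2 * (value p a + 2 ^ j);
  counter_done : forall a', value p a' < value p a + 2 ^ j ->
    value p a' = value p a \/ ~~ test a';
  counter_cot : all is_cot h }.

(** The default [Vsep] in [carry_next] stands for the last token of the prompt, so the first carry
    is at bit 0. *)
Lemma counter_state0 : 0 < p -> counter_state [::] (fun=> false) 0.
Proof.
have w0 w : weight w p (fun=> false) = 0 by apply: big1.
move=> p_gt0; split=> //=; first by rewrite p_gt0.
  by rewrite /popcount /value !w0.
by move=> a'; rewrite /value w0 add0n ltnS leqn0 => /eqP ->; left.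
Qed.

(** Clearing a one bit moves the carry to [j.+1] and leaves the pending value unchanged. Setting a
    zero bit turns the pending value into the current one and starts a carry at bit 0. *)
Lemma counter_stateS h a j (lt_jp : j < p) : counter_state h a j -> ~~ test a ->
  exists a' j', counter_state (rcons h (Cot (a j) (Ordinal lt_jp))) a' j'.
Proof.
case=> _ low next bits sz seen cot a_bad.
have seen' a' : value p a' < value p a + 2 ^ j -> ~~ test a'.
  by move=> /seen [/test_value ->|].
exists (set_bit a j (~~ a j)), (if a j then j.+1 else 0).
have val_a := weight_set_bit (expn 2) a (~~ a j) lt_jp.
have pop_a := weight_set_bit (fun=> 1) a (~~ a j) lt_jp.
move: val_a pop_a; rewrite -!/(value _ _) -!/(popcount _ _) => val_a pop_a.
split.
- by case: (a j).
- case aj : (a j) => // i; rewrite ltnS leq_eqVlt /set_bit.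
  by case: eqVneq => //= _ /low.
- by rewrite last_rcons /=; case: (a j) => //; rewrite (leq_ltn_trans _ lt_jp).
- move=> i; rewrite -cats1 !count_cat bits /= !addn0 /set_bit.
  have cotE c c' : (Cot c (Ordinal lt_jp) == Cot c' i) = (c == c') && (i == j :> nat).
    apply/eqP/andP => [[-> <-] //|[/eqP -> /eqP ij]].
    by congr Cot; apply: val_inj.
  rewrite !cotE; case: (eqVneq (i : nat) j) => [->|_]; last by rewrite !andbF !addn0.
  by rewrite !andbT; case: (a j) => /=; lia.
- rewrite size_rcons; move: val_a pop_a; case: (a j) => /=; rewrite ?expnS; lia.
- move=> a'; move: val_a; case: (a j) => /= val_a.
    by rewrite expnS => lt_a'; right; apply: seen'; lia.
  rewrite expn0 addn1 ltnS leq_eqVlt => /orP[/eqP ->|lt_a']; first by left.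
  by right; apply: seen'; lia.
- by rewrite all_rcons.
Qed.

(** With the carry at [p] the pending value is at least [2 ^ p], which exceeds the value of every
    assignment. *)
Lemma counter_overflow h a : counter_state h a p -> ~~ test a ->
  forall a', ~~ test a'.
Proof.
case=> _ low _ _ _ seen _ a_bad a'.
suff lt_a' : value p a' < value p a + 2 ^ p.
  by have [/test_value ->|] := seen a' lt_a'.
have := @value_carry_le p a' 0 isT (fun _ => ltac:(by [])); rewrite expn0 addn1.
by move=> /leq_trans -> //; rewrite leq_addl.
Qed.

Lemma counter_size_le h a j : counter_state h a j -> size h + 2 <= 2 ^ p.+1.
Proof.
by case=> le_jp low _ _ sz _ _; have := value_carry_le le_jp low; rewrite expnS; lia.
Qed.

Variables (R : realType) (M : transformer R) (x : seq (token M)).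
Variables (enc : voc p -> token M).
Hypothesis enc_inj : injective enc.
(** The interface between counter and transformer; [insub j] fails exactly at the overflow
    [j = p]. *)
Hypothesis next_tokenE : forall h a j, counter_state h a j ->
  next_token (x ++ map enc h) = Some (enc (if test a then Vacc
    else if insub j is Some i then Cot (a j) i else Vrej)).

Lemma greedy_cot1 (E0 E1 v : token M) (y : seq (token M)) :
  next_token y = Some v -> (v == E0) || (v == E1) -> greedy_cot E0 E1 y [:: v].
Proof.
move=> ny vE; split=> //= -[|j] // _.
by exists v; rewrite cats0.
Qed.

Lemma greedy_cot_cons (E0 E1 v : token M) (y t : seq (token M)) :
  next_token y = Some v -> v != E0 -> v != E1 ->
  greedy_cot E0 E1 (rcons y v) t -> greedy_cot E0 E1 y (v :: t).
Proof.
move=> ny v0 v1 [t_nil next_t stop_t go_t]; split=> //.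
- case=> [|j] /= lt_j; first by exists v; rewrite cats0.
  by have [u [nu tj]] := next_t j lt_j; exists u; rewrite -cat_rcons.
- by case: t t_nil stop_t {next_t go_t}.
- by case=> [|j] //= lt_j u; apply: go_t.
Qed.

Lemma counter_terminates h a j : counter_state h a j ->
  exists t, [/\ greedy_cot (enc Vrej) (enc Vacc) (x ++ map enc h) t,
    size h + size t < 2 ^ p.+1 &
    cot_output (enc Vrej) t = 1 <-> exists a, test a].
Proof.
have acc_rej : enc Vacc != enc Vrej by apply/eqP => /enc_inj.
(* Induction on the room left below the length bound of [counter_size_le]. *)
move: {2}(2 ^ p.+1 - size h) (leqnn (2 ^ p.+1 - size h)) => m.
elim: m h a j => [|m IHm] h a j le_m st; have sz := counter_size_le st; first lia.
have := next_tokenE st; case: (boolP (test a)) => [ta|nta] next.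
  exists [:: enc Vacc]; split; first by apply: greedy_cot1; rewrite ?eqxx ?orbT.
    by rewrite /=; lia.
  by rewrite /cot_output /= (negPf acc_rej); split=> // _; exists a.
have := carry_le st; rewrite leq_eqVlt => /orP[/eqP jp|lt_jp]; last first.
  move: next; rewrite insubT => next.
  have [a' [j' st']] := counter_stateS lt_jp st nta.
  have [|t [gt szt out]] := IHm _ _ _ _ st'; first by rewrite size_rcons; lia.
  exists (enc (Cot (a j) (Ordinal lt_jp)) :: t); split.
  - apply: greedy_cot_cons; rewrite ?next //; try by apply/eqP => /enc_inj.
    by rewrite rcons_cat -map_rcons.
  - by move: szt; rewrite size_rcons /=; lia.
  - rewrite -out /cot_output /=; case: t gt {szt out} => // -[].
    by [].
move: next; rewrite insubF ?jp ?ltnn // => next.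
exists [:: enc Vrej]; split; first by apply: greedy_cot1; rewrite ?eqxx.
  by rewrite /=; lia.
rewrite /cot_output /= eqxx; split=> // -[a' ta'].
by move: st; rewrite jp => /counter_overflow /(_ nta a'); rewrite ta'.
Qed.

End CounterRun.

(** * DIMACS prompts as token sequences *)

Section Encoding.
Variable p : nat.

(** Variables are numbered from 1 in DIMACS and from 0 in [voc], whence the predecessor; the final
    [Vend] is a filler outside the alphabet. *)
Definition encode (x : dtoken) : voc p :=
  match x with
  | BOS => Vbos
  | SEP => Vsep
  | Defs.Num z => if z == 0 then Vend
             else if insub (absz z).-1 is Some j then Lit (0 < z) j else Vend
  end.

Arguments encode : simpl never.

Lemma encode_lit z : z != 0 -> (absz z <= p)%N ->
  exists2 j : 'I_p, encode (Defs.Num z) = Lit (0 < z) j & absz z = j.+1.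
Proof.
move=> z0 le_zp; rewrite /encode (negPf z0).
have lt_z : ((absz z).-1 < p)%N by lia.
by rewrite insubT; exists (Ordinal lt_z) => //=; lia.
Qed.

Lemma encode_inj x y : in_alphabet p x -> in_alphabet p y ->
  encode x = encode y -> x = y.
Proof.
have [n0 numE] : encode (Defs.Num 0) = Vend /\ forall z, (absz z <= p)%N ->
    encode (Defs.Num z) = Vend -> z = 0.
  split=> // z le_z; have [//|z0] := eqVneq z 0.
  by have [j ->] := encode_lit z0 le_z.
have num_neq z w : (absz z <= p)%N -> w = Vbos \/ w = Vsep -> encode (Defs.Num z) = w -> False.
  move=> le_z ww; have [->|z0] := eqVneq z 0; first by case: ww => ->.
  by have [j -> _] := encode_lit z0 le_z; case: ww => ->.
case: x => [||z]; case: y => [||z'] //= hx hy.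
- by move/esym/num_neq => []//; left.
- by move/esym/num_neq => []//; right.
- by move/num_neq => []//; left.
- by move/num_neq => []//; right.
have [->|z0] := eqVneq z 0; first by rewrite n0 => /esym /(numE _ hy) ->.
have [->|z'0] := eqVneq z' 0; first by rewrite n0 => /(numE _ hx) ->.
have [j -> jE] := encode_lit z0 hx; have [j' -> jE'] := encode_lit z'0 hy.
case=> sgn jj; congr Defs.Num; move: jE jE'; rewrite jj => jE jE'.
by move: sgn; case: ltP => ?; case: ltP => ? // _; lia.
Qed.

Lemma scan_cat_cot T seen (s h : seq (voc p)) :
  all (@is_cot p) h -> scan T seen (s ++ h) = scan T seen s.
Proof.
move=> cot_h; elim: s seen => [|x s IHs] seen /=; last by rewrite !IHs.
elim: h cot_h seen => [|x h IHh] //= /andP[cot_x cot_h] seen.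
case: eqVneq cot_x => [->|_ _] //; exact: IHh.
Qed.

Lemma scan_clause T seen (cl : seq int) s :
  (forall l, l \in cl -> l != 0 /\ (absz l <= p)%N) ->
  scan T seen (map encode (rcons (map Defs.Num cl) (Defs.Num 0)) ++ s) =
  (seen || has (T \o encode \o Defs.Num) cl) && scan T false s.
Proof.
elim: cl seen => [|l cl IHcl] seen lits /=; first by rewrite orbF eqxx.
have [l0 le_l] := lits l (mem_head _ _).
rewrite !IHcl; try by move=> l' l'_cl; apply: lits; rewrite inE l'_cl orbT.
have [j -> _] := encode_lit l0 le_l.
by rewrite -orbA; case: eqVneq.
Qed.

Lemma scan_dimacs c F a : valid_cnf p c F ->
  scan (lit_holds a) false (map encode (dimacs F)) =
  all (fun cl => has (lit_true (fun i => a i.-1)) cl) F.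
Proof.
case=> _ valid; rewrite /dimacs /=.
rewrite -[encode BOS]/Vbos.
have /negPf -> : Vbos != Vend :> voc p by apply/eqP.
elim: F valid => [|cl F IHF] valid /=.
  by case: eqVneq.
have [_ lits] := valid cl (mem_head _ _).
rewrite -catA map_cat scan_clause // IHF; last first.
  by move=> cl' cl'F; apply: valid; rewrite inE cl'F orbT.
congr (_ && _); apply: eq_in_has => l /lits [l0 le_l].
have [j /= encE jE] := encode_lit l0 le_l; rewrite /= encE.
by rewrite /lit_true jE /=; case: ltP; case: (a j).
Qed.

(** The prompt contributes nothing to the bits, so the counter starts at zero. *)
Lemma count_cot_encode c (j : 'I_p) (s : seq dtoken) :
  count_mem (Cot c j) (map encode s) = 0%N.
Proof.
elim: s => //= x s ->; rewrite addn0.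
case: eqVneq => // /esym; case: x => // z.
by rewrite /encode; case: ifP => // _; case: insub.
Qed.

Lemma size_dimacs c F : valid_cnf p c F -> (size (dimacs F) <= 4 * c + 2)%N.
Proof.
case=> szF valid; rewrite /= size_cat addn1.
suff : (size (flatten [seq rcons (map Defs.Num cl) (Defs.Num 0) | cl <- F]) <= 4 * size F)%N.
  by lia.
elim: F valid {szF} => //= cl F IHF valid.
have [/andP[_ szcl] _] := valid cl (mem_head _ _).
have := IHF (fun cl' clF => valid cl' (mem_behead (s := cl :: F) clF)).
by rewrite size_cat size_rcons size_map; lia.
Qed.

End Encoding.

(** * The seven-layer machine and its logits *)

Section Machine.
Variables (R : realType) (p N : nat).
Notation V := (voc p).
Notation J := (residual_coord p).
Notation D := (option V).

Let beta : R := 4 * N%:R ^+ 2.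
Let gamma : R := 80 * N%:R ^+ 2.
Let theta : R := 40 * N%:R.

Notation mk_layer := (@fun_layer R J D V (fun v => cP v) cpos).

(** Layers 3 to 6 are the identity through the residual connection. *)
Definition sat_layer (l : nat) : layer R #|{: J}| #|{: D}| #|{: V}| 5 :=
  match l with
  | 0 => mk_layer (fun _ _ => 0) (fun _ _ => 0) (@copy_value R p) (@to_counts R p)
           (@counts_out R p)
  | 1 => mk_layer (@clause_query R p) (@clause_key R p beta) (@copy_value R p)
           (@to_clause R p) (fun _ _ => 0)
  | 2 => mk_layer (@check_query R p) (@check_key R p gamma theta) (@check_value R p)
           (@to_check R p) (fun _ _ => 0)
  | _ => mk_layer (fun _ _ => 0) (fun _ _ => 0) (fun _ _ => 0) (fun _ _ => 0)
           (fun _ _ => 0)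
  end.

Definition sat_machine : transformer R :=
  {| nV := #|{: V}|; demb := #|{: J}|; dh := #|{: D}|; dff := #|{: V}|;
     nL := 7; nH := 5;
     Emb := mx_of_fun (fun (v : V) (j : J) => if j is cE u then (v == u)%:R else 0);
     pos_coord := enum_rank (cpos : J);
     layers := fun l => sat_layer l;
     Wout := mx_of_fun (@out_weight R p);
     bout := 0 |}.

Variable s : seq (token sat_machine).
Let tok (i : 'I_(size s)) : V := enum_val (tnth (in_tuple s) i).

Lemma forwardE : forward s =
  mx_of_rows (residual tok (token_count R tok) (clause_mass beta tok)
    (falsified beta gamma theta tok)).
Proof.
rewrite /forward.
have -> : enum 'I_(nL sat_machine) =
    [seq inord i | i <- [:: 0; 1; 2; 3; 4; 5; 6]%N] :> seq 'I_7.
  apply: (inj_map val_inj); rewrite /= val_enum_ord /=.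
  by rewrite !inordK.
rewrite /= !inordK //=.
have -> : input_matrix s =
    mx_of_rows (residual tok (fun _ _ => 0) (fun _ _ => 0) (fun=> 0)).
  apply/matrixP => i b; rewrite !mxE -[b == _](inj_eq enum_val_inj) /= enum_rankK.
  by case: (enum_val b) => [[[v|v]|v]|[]]; rewrite /= ?addr0 ?add0r.
by rewrite layer_counts layer_clause layer_check !layer_idle.
Qed.

Lemma logitsE (i : 'I_(size s)) w : i.+1 = size s ->
  logits s w = logit_spec beta gamma theta tok i (enum_val w).
Proof.
move=> iE; rewrite /logits (bigD1 i) ?iE //= big1 ?addr0; last first.
  move=> k /andP[/eqP kE /eqP[]]; apply: val_inj; apply: succn_inj.
  by rewrite kE iE.
by rewrite forwardE mul_mx_of_fun !mxE addr0 sum_out_weight.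
Qed.

End Machine.

Lemma next_token_strict (R : realType) (M : transformer R) (s : seq (token M)) v :
  (forall w, w != v -> logits s w < logits s v) -> next_token s = Some v.
Proof.
move=> vmax; rewrite /next_token; case: pickP => [u /forallP umax|none].
  apply/eqP; rewrite (inj_eq Some_inj); apply: contraT => /vmax.
  by rewrite ltNge umax.
have /forallP[] := none v => w.
by have [->//|/vmax/ltW] := eqVneq w v.
Qed.

(** * One greedy decoding step *)

Section MachineStep.
Variables (R : realType) (p N : nat).
Notation M := (sat_machine R p N).

(** [falsified_le] and [falsified_ge] put the logit of [Vacc] above or below that of the counter's
    own move; the margins in [out_weight] then make [v] the strict maximiser, so no tie arises. *)
Lemma machine_next_token (s : seq (voc p)) (a : nat -> bool) (v : voc p) :
  s = Vbos :: behead s -> (size s <= N)%N ->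
  (forall j : 'I_p, count_mem (Cot false j) s = (count_mem (Cot true j) s + a j)%N) ->
  v = (if scan (lit_holds a) false s then Vacc
       else if next_bit (last Vbos s) is Some j
            then if insub j is Some i then Cot (a j) i else Vrej
            else Vrej) ->
  (forall j, next_bit (last Vbos s) = Some j -> (j < p)%N) ->
  @next_token R M (map enum_rank s) = Some (enum_rank v).
Proof.
move=> s0 le_sN bits vE next_lt; apply: next_token_strict => w.
set s' := map _ s in w *.
have sz : size s = size s' by rewrite size_map.
have s'_gt0 : (0 < size s')%N by rewrite -sz s0.
have last_lt : ((size s').-1 < size s')%N by rewrite prednK.
pose i := Ordinal last_lt; pose i0 := Ordinal s'_gt0.
have iE : i.+1 = size s' by rewrite /= prednK.
rewrite !(logitsE _ iE) enum_rankK.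
rewrite -[w]enum_valK (inj_eq enum_rank_inj) enum_rankK.
move: (enum_val w) => {}w w_v.
set tok := fun _ => _.
have tokE k : tok k = nth Vbos s k.
  by rewrite /tok (tnth_nth (enum_rank Vbos)) /= (nth_map Vbos) ?enum_rankK // sz.
have tok0 : tok i0 = Vbos by rewrite tokE s0.
have tok_i : tok i = last Vbos s by rewrite tokE -nth_last sz.
have le_N : (size s' <= N)%N by rewrite -sz.
have truthE' u := @truthE R p _ s tok sz tokE i a iE bits u.
have fle := @falsified_le R p _ N s tok sz tokE le_N i i0 a iE erefl tok0 bits.
have fge := @falsified_ge R p _ N s tok sz tokE le_N i a iE bits.
have truth01 u : 0 <= truth R tok i u <= 1.
  by rewrite truthE'; case: (lit_holds a u); rewrite /= ?lexx ?ler01.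
move: fle fge w_v; rewrite vE; case: ifP => _.
  move=> /(_ isT) fle _ w_v.
  move: w_v; rewrite /logit_spec; case: w => [b j|c j| | | | |]; rewrite ?eqxx //; move=> _; try lra.
    by have := truth01 (Lit c j); case: eqP => _ /=; lra.
  by case: eqP => _ /=; lra.
move=> _ /(_ isT) fge; move: next_lt; rewrite /logit_spec !tok_i.
case: (next_bit (last Vbos s)) => [j|] next_lt.
  have lt_j := next_lt j erefl; rewrite insubT /= eqxx.
  have -> : truth R tok i (Lit (a j) (Ordinal lt_j)) = 1 by rewrite truthE' /= eqxx.
  case: w => [b k|c k| | | | |]; rewrite ?eqxx //= => w_v; try lra.
  have := truth01 (Lit c k); case: (eqVneq (Some j) (Some (k : nat))) => [[jk]|_] /=; last by lra.
  have -> : truth R tok i (Lit c k) = 0.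
    rewrite truthE' /= -jk; case: eqP => // ac; case/eqP: w_v.
    by rewrite ac; congr Cot; apply: val_inj.
  by lra.
case: w => [b k|c k| | | | |]; rewrite ?eqxx //= => _; try lra.
by have := truth01 (Lit c k); lra.
Qed.

End MachineStep.

(** * Correctness and size of the machine *)

Lemma card_residual_coord p : #|{: residual_coord p}| = (12 * p + 17)%N.
Proof. by rewrite !card_sum card_bool card_voc; lia. Qed.

(** The length bound given to the machine adds [4 * c + 2] for the prompt and [2 ^ p.+1] for the
    chain of thought. *)
Lemma sat_machine_decides (R : realType) (p c : nat) (F : cnf) : (0 < p)%N ->
  valid_cnf p c F ->
  let M := sat_machine R p (4 * c + 2 + 2 ^ p.+1) in
  let enc (v : voc p) : token M := enum_rank v in
  exists t : seq (token M),
    [/\ greedy_cot (enc Vrej) (enc Vacc) (map (enc \o @encode p) (dimacs F)) t,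
        (size t <= p * 2 ^ p.+1)%N &
        (cot_output (enc Vrej) t = 1%N <-> satisfiable F)].
Proof.
move=> p_gt0 valid M enc.
pose test a := all (fun cl => has (lit_true (fun i => a i.-1)) cl) F.
have test_ext a a' : value p a = value p a' -> test a = test a'.
  move=> /value_inj aa; apply: eq_in_all => cl /(proj2 valid) [_ lits].
  apply: eq_in_has => l /lits [l0 le_l]; rewrite /lit_true !aa //; lia.
have enc_inj : injective enc by apply: enum_rank_inj.
have nextE h a j : counter_state test h a j ->
    next_token (map (enc \o @encode p) (dimacs F) ++ map enc h) =
    Some (enc (if test a then Vacc
      else if insub j is Some i then Cot (a j) i else Vrej)).
  move=> st; rewrite map_comp -map_cat.
  have last_s : last Vbos (map (@encode p) (dimacs F) ++ h) = last Vsep h.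
    rewrite last_cat; case: h st => //= _.
    by rewrite map_cat last_cat.
  apply: (@machine_next_token R p _ _ a); rewrite ?last_s.
  - by [].
  - rewrite size_cat size_map leq_add ?(size_dimacs valid) //.
    by apply: leq_trans (counter_size_le st); rewrite leq_addr.
  - by move=> i; rewrite !count_cat !count_cot_encode (counter_bits st).
  - rewrite scan_cat_cot ?(counter_cot st) // (scan_dimacs _ valid) (carry_next st).
    by case: (ltnP j p) => // le_pj; rewrite insubF // ltnNge le_pj.
  - by move=> j'; rewrite (carry_next st); case: ifP => // lt_j [<-].
have [t [gt szt out]] := counter_terminates test_ext enc_inj nextE
  (counter_state0 test p_gt0).
exists t; split; first by rewrite cats0 in gt.
  by apply: leq_trans (leq_pmull _ p_gt0); rewrite ltnW.
rewrite out; split=> -[a sat]; first by exists (fun i => a i.-1).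
(* Variable [i.+1] of the formula is bit [i] of the counter. *)
exists (a \o succn); rewrite /test -(eq_in_all (a1 := fun cl => has (lit_true a) cl)) //.
move=> cl /(proj2 valid) [_ lits]; apply: eq_in_has => l /lits [l0 _].
by rewrite /lit_true /= prednK // absz_gt0.
Qed.

Theorem mainTheorem1 (R : realType) :
  exists C : nat,
  forall p c : nat, (0 < p)%N -> (0 < c)%N ->
  exists (M : transformer R) (enc : dtoken -> token M) (E0 E1 : token M),
    [/\ nL M = 7%N /\ nH M = 5%N,
        (demb M <= C * p)%N /\ (param_count M <= C * p ^ 2)%N,
        (forall x y, in_alphabet p x -> in_alphabet p y -> enc x = enc y -> x = y),
        E0 != E1 &
        forall F : cnf, valid_cnf p c F ->
          exists t : seq (token M),
            [/\ greedy_cot E0 E1 (map enc (dimacs F)) t,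
                (size t <= p * 2 ^ p.+1)%N &
                (cot_output E0 t = 1%N <-> satisfiable F)]].
Proof.
(* For [p >= 1] the embedding, head and hidden dimensions and the vocabulary size are at most [29p],
   [10p], [9p] and [9p], which keeps the parameter count below [5 * 10 ^ 4 * p ^ 2]. *)
exists (10 ^ 5)%N => p c p_gt0 _.
exists (sat_machine R p (4 * c + 2 + 2 ^ p.+1)).
exists (fun x => enum_rank (encode p x)), (enum_rank Vrej), (enum_rank Vacc); split.
- by [].
- rewrite /param_count /= card_option card_residual_coord card_voc.
  by split; nia.
- by move=> x y px py /enum_rank_inj /(encode_inj px py).
- by rewrite (inj_eq enum_rank_inj); apply/eqP.
- by move=> F valid; apply: sat_machine_decides.
Qed.
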